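(* Let $P \subset \mathbb{R}^n$ be a rational full-dimensional polytope, and let $1 \le k \le n$. Then the $k$-dimensional skeleton of the normal fan of $P$ is $k$-connected through codimension one.
   Context: A polytope is rational if its vertices lie in $\mathbb{Q}^n$; full-dimensional means of dimension $n$ in $\mathbb{R}^n$. The normal fan of $P$ is the complete polyhedral fan in $\mathbb{R}^n$ whose cones are the normal cones of the faces of $P$, and its $k$-dimensional skeleton is the subfan consisting of all cones of dimension at most $k$; it is a pure $k$-dimensional polyhedral fan. Connectivity: the facets and ridges of a pure $k$-dimensional polyhedral complex are its faces of dimension $k$ and $k-1$, respectively. The complex is connected through codimension one if between any two facets there is a path that goes through facets and ridges only. The facet-ridge hypergraph has the facets as vertices and the ridges as hyperedges, the hyperedge of a ridge $\tau$ being the set of facets containing $\tau$. A hypergraph is connected if there is a path from any vertex to any other vertex in which each step connects two vertices in the same hyperedge. A hypergraph is $m$-connected if it remains connected after any $m-1$ vertices and all hyperedges incident to them are removed (a hyperedge containing a removed vertex is deleted entirely). A pure polyhedral complex is $m$-connected through codimension one if removing any $m-1$ closed facets leaves it connected through codimension one; equivalently, its facet-ridge hypergraph is $m$-connected. *)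

(* Defs.v *)
From HB Require Import structures.
From mathcomp Require Import all_boot all_order all_algebra.
From mathcomp Require Import boolp classical_sets functions cardinality reals.
From mathcomp Require Import convex.

Set Implicit Arguments.
Unset Strict Implicit.
Unset Printing Implicit Defensive.

Import Order.TTheory GRing.Theory Num.Theory.
Local Open Scope classical_set_scope.
Local Open Scope card_scope.
Local Open Scope ring_scope.

Section dimension.
Variables (R : realType) (n : nat).
Implicit Types (A : set 'rV[R]_n) (W : {vspace 'rV[R]_n}).

(* The space of directions of the affine hull of A, characterized as the
   smallest linear subspace containing all differences of points of A. *)
Definition is_direction A W : Prop :=
  (forall x y, A x -> A y -> x - y \in W) /\
  (forall W', (forall x y, A x -> A y -> x - y \in W') -> (W <= W')%VS).

Lemma is_direction_exists A : exists W, is_direction A W.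
Proof.
pose Q W := forall x y, A x -> A y -> x - y \in W.
pose D d := `[< exists2 W, Q W & \dim W = d >].
have exD : exists d, D d.
  exists (\dim (fullv : {vspace 'rV[R]_n})); apply/asboolP.
  by exists fullv => // x y _ _; rewrite memvf.
case: (ex_minnP exD) => d /asboolP [W QW dW] minW.
exists W; split=> // W' QW'.
have QI : Q (W :&: W')%VS by move=> x y Ax Ay; rewrite memv_cap QW // QW'.
have le_d : (\dim W <= \dim (W :&: W'))%N.
  by rewrite dW; apply: minW; apply/asboolP; exists (W :&: W')%VS.
apply/capv_idPl/eqP; rewrite eqEdim capvSl; exact: le_d.
Qed.

Definition direction A : {vspace 'rV[R]_n} := xget 0%VS (is_direction A).

Lemma directionP A : is_direction A (direction A).
Proof. exact: xgetPex (is_direction_exists A). Qed.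

(* The empty set gets dimension 0 under this definition. *)
Definition dim A : nat := \dim (direction A).

End dimension.

Section polytope.
Variables (R : realType) (n : nat).
Implicit Types (P F : set 'rV[R]_n) (c : 'rV[R]_n).

Definition dot (u v : 'rV[R]_n) : R := \sum_(i < n) u 0 i * v 0 i.

Definition convex_hull (S : set 'rV[R]_n) : set 'rV[R]_n :=
  smallest (@convex_set R 'rV[R]_n) S.

Definition polytope P : Prop :=
  exists2 S : set 'rV[R]_n, finite_set S & P = convex_hull S.

Definition full_dimensional P : Prop := dim P = n.

Definition max_face P c : set 'rV[R]_n :=
  [set x | P x /\ forall y, P y -> dot c y <= dot c x].

(* P itself is a face (c = 0); the empty face is excluded, since it has no
   normal cone. *)
Definition face P F : Prop := F !=set0 /\ exists c, F = max_face P c.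

Definition vertex P (v : 'rV[R]_n) : Prop := face P [set v].

Definition rational_polytope P : Prop :=
  forall v, vertex P v -> forall i, rational (v 0 i).

(* Outer normals are used; inner normals would give the opposite fan. *)
Definition normal_cone P F : set 'rV[R]_n := [set c | F `<=` max_face P c].

Definition normal_fan P : set (set 'rV[R]_n) := normal_cone P @` face P.

Definition skeleton (Sigma : set (set 'rV[R]_n)) (k : nat) :
  set (set 'rV[R]_n) := [set C | Sigma C /\ (dim C <= k)%N].

End polytope.

Record hypergraph (V : Type) := Hypergraph {
  hvertices : set V;
  hyperedges : set (set V);
  hyperedges_sub : forall e, hyperedges e -> e `<=` hvertices }.

Section hypergraph.
Variable V : Type.
Implicit Types (H : hypergraph V) (S : set V).

Lemma delete_subproof H S e :
  [set e | hyperedges H e /\ e `&` S = set0] e -> e `<=` hvertices H `\` S.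
Proof.
move=> [He eS] x ex; split; first exact: (hyperedges_sub He).
by move=> Sx; have : (e `&` S) x by []; rewrite eS.
Qed.

Definition delete H S : hypergraph V :=
  Hypergraph (@delete_subproof H S).

Definition in_same_hyperedge H (x y : V) : Prop :=
  exists e, [/\ hyperedges H e, e x & e y].

Definition hconnected H : Prop :=
  forall x y, hvertices H x -> hvertices H y ->
  exists2 p : seq V,
    path (fun a b => `[< in_same_hyperedge H a b >]) x p & last x p = y.

(* Meaningful for m >= 1 only. *)
Definition m_connected (m : nat) H : Prop :=
  forall S, S `<=` hvertices H -> S #= `I_(m.-1) -> hconnected (delete H S).

End hypergraph.

Section codimension_one.
Variables (R : realType) (n : nat).
Implicit Types (Sigma : set (set 'rV[R]_n)) (d : nat).

(* In what follows Sigma is a polyhedral complex, given as the set of its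
   faces, and d is its dimension. *)
Definition facets Sigma d : set (set 'rV[R]_n) :=
  [set C | Sigma C /\ dim C = d].

Definition ridges Sigma d : set (set 'rV[R]_n) :=
  [set C | Sigma C /\ (dim C).+1 = d].

Definition ridge_hyperedge Sigma d (tau : set 'rV[R]_n) :
  set (set 'rV[R]_n) := [set C | facets Sigma d C /\ tau `<=` C].

Lemma facet_ridge_subproof Sigma d e :
  (ridge_hyperedge Sigma d @` ridges Sigma d) e -> e `<=` facets Sigma d.
Proof. by move=> [tau _ <-] C []. Qed.

Definition facet_ridge_hypergraph Sigma d : hypergraph (set 'rV[R]_n) :=
  Hypergraph (@facet_ridge_subproof Sigma d).

Definition m_connected_codim1 (m : nat) Sigma d : Prop :=
  m_connected m (facet_ridge_hypergraph Sigma d).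

End codimension_one.

(* Main.v *)
Require Import Defs.
From mathcomp Require Import all_boot all_order all_algebra.
From mathcomp Require Import boolp classical_sets reals.
From mathcomp Require Import functions cardinality convex interval_inference.
From mathcomp Require Import lra.
From Stdlib Require Import Relation_Operators Operators_Properties.

(** Under duality, the cones of dimension [k] of the normal fan are the faces of
    codimension [k] of the polytope, and a cone is contained in another one when
    the opposite inclusion holds between the faces. The claim therefore becomes:
    after deleting [k - 1] faces of codimension [k], together with all faces of
    codimension [k - 1] containing one of them, the remaining faces of
    codimension [k] are connected through the remaining faces of codimension
    [k - 1]. For [k = n] this is Balinski's theorem on the graph of a polytope.

    The proof deletes points instead of faces. A face contains a given face [F]
    exactly when it contains a chosen relative interior point of [F], so it
    suffices to prove ([faces_conn]): if fewer than [k] points of an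
    [n]-dimensional polytope are given, then the faces of codimension [k]
    containing none of them are connected through the faces of codimension
    [k - 1] containing none of them. In this form the statement follows from the
    case [k = n] by downward induction. Two faces of codimension [k] that avoid
    the points have subfaces of codimension [k + 1], which avoid the points as
    well and which, by the induction hypothesis, are joined by a chain whose
    neighbouring members [u] and [u'] lie in a common face of codimension [k]
    that avoids the points. So it is enough to connect the faces of codimension
    [k] around a single face [u] of codimension [k + 1] ([star_conn]). These are
    the vertices of the link of [u], a polytope of dimension [k] whose edges are
    the faces of codimension [k - 1] around [u]. Projecting the deleted points
    from [u] to the link reduces the question to the case of vertices and edges
    for the link, with fewer deleted points than its dimension.

    The case of vertices and edges ([balinski]) has the classical proof. Take a
    functional that is not constant on the polytope, but takes the same value on
    all deleted points and on one of the two vertices to be joined. Walking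
    along edges that increase it, both vertices reach the face where it is
    maximal, and this face contains no deleted point. (If the other vertex lies
    below, use the opposite functional.)

    Polytopes are handled as bounded systems of linear inequalities, obtained
    from the vertices by Fourier-Motzkin elimination ([polytope_system]). A face
    is represented by a relative interior point [x], that is by the set of
    inequalities that are tight at [x]; the dimension of the normal cone is the
    dimension of the span of their normals ([dim_cone_at]). *)

Set Implicit Arguments.
Unset Strict Implicit.
Unset Printing Implicit Defensive.

Import Order.TTheory GRing.Theory Num.Theory.
Local Open Scope ring_scope.

(** * The dot product and orthogonal complements *)

Section dot.
Variables (R : realType) (n : nat).
Implicit Types (u v w : 'rV[R]_n) (U W : {vspace 'rV[R]_n}).

Lemma dotC u v : dot u v = dot v u.
Proof. by apply: eq_bigr => i _; rewrite mulrC. Qed.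

Lemma dotDr u v w : dot u (v + w) = dot u v + dot u w.
Proof. by rewrite -big_split; apply: eq_bigr => i _; rewrite mxE mulrDr. Qed.

Lemma dotZr a u v : dot u (a *: v) = a * dot u v.
Proof. by rewrite mulr_sumr; apply: eq_bigr => i _; rewrite mxE mulrCA. Qed.

Lemma dotNr u v : dot u (- v) = - dot u v.
Proof. by rewrite -scaleN1r dotZr mulN1r. Qed.

Lemma dotBr u v w : dot u (v - w) = dot u v - dot u w.
Proof. by rewrite dotDr dotNr. Qed.

Lemma dotDl u v w : dot (u + v) w = dot u w + dot v w.
Proof. by rewrite !(dotC _ w) dotDr. Qed.

Lemma dotZl a u v : dot (a *: u) v = a * dot u v.
Proof. by rewrite !(dotC _ v) dotZr. Qed.

Lemma dotNl u v : dot (- u) v = - dot u v.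
Proof. by rewrite !(dotC _ v) dotNr. Qed.

Lemma dotBl u v w : dot (u - v) w = dot u w - dot v w.
Proof. by rewrite dotDl dotNl. Qed.

Lemma dot0l v : dot 0 v = 0.
Proof. by rewrite -(scale0r 0) dotZl mul0r. Qed.

Lemma dot_suml (I : Type) (r : seq I) (Q : pred I) (F : I -> 'rV[R]_n) v :
  dot (\sum_(i <- r | Q i) F i) v = \sum_(i <- r | Q i) dot (F i) v.
Proof. by elim/big_rec2: _ => [|i y1 y2 _ <-]; rewrite ?dot0l ?dotDl. Qed.

Lemma dot_ge0 u : 0 <= dot u u.
Proof. by apply: sumr_ge0 => i _; rewrite -expr2 sqr_ge0. Qed.

Lemma dot_eq0 u : (dot u u == 0) = (u == 0).
Proof.
apply/idP/eqP => [|->]; last by rewrite dot0l.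
rewrite psumr_eq0 => [/allP u0|i _]; last by rewrite -expr2 sqr_ge0.
apply/rowP => i; rewrite mxE; apply/eqP.
by have := u0 i (mem_index_enum _); rewrite mulf_eq0 orbb.
Qed.

Lemma dot_gt0 u : (0 < dot u u) = (u != 0).
Proof. by rewrite lt_neqAle eq_sym dot_eq0 dot_ge0 andbT. Qed.

(** The orthogonal complement, as the kernel of the map pairing a vector with
    a basis of [U]; this presentation bounds its dimension from below. *)
Definition orth U : {vspace 'rV[R]_n} :=
  lker (linfun (mulmxr (\matrix_(j < n, i < \dim U) (vbasis U)`_i 0 j))).

Lemma orthP U v : reflect (forall u, u \in U -> dot u v = 0) (v \in orth U).
Proof.
rewrite memv_ker lfunE /=; apply: (iffP eqP) => [Mv u Uu|v0].
  rewrite (coord_vbasis Uu) dot_suml big1 // => i _; rewrite dotZl.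
  move/rowP/(_ i): Mv; rewrite !mxE => Mv.
  suff -> : dot (vbasis U)`_i v = 0 by rewrite mulr0.
  by rewrite dotC; apply: etrans Mv; apply: eq_bigr => j _; rewrite mxE.
apply/rowP => i; rewrite !mxE.
have /v0 : (vbasis U)`_i \in U by apply: vbasis_mem; rewrite mem_nth ?size_tuple.
by rewrite dotC; apply: etrans; apply: eq_bigr => j _; rewrite mxE.
Qed.

Lemma orth_span (l : seq 'rV[R]_n) v :
  (forall u, u \in l -> dot u v = 0) -> v \in orth <<l>>.
Proof.
move=> lv; apply/orthP => u ul; apply/eqP.
suff : u \in orth <[v]>.
  by move/orthP => /(_ v (memv_line v)) uv; rewrite dotC uv.
apply: (subvP _ _ ul); apply/span_subvP => w /lv wv.
by apply/orthP => _ /vlineP[a ->]; rewrite dotZl dotC wv mulr0.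
Qed.

Lemma capv_orth U : (U :&: orth U)%VS = 0%VS.
Proof.
apply/eqP; rewrite -subv0; apply/subvP => v; rewrite memv_cap => /andP[Uv /orthP].
by move=> /(_ v Uv)/eqP; rewrite dot_eq0 memv0.
Qed.

(** The rank theorem gives one inequality, and positive definiteness of the dot
    product, which makes [U] and [orth U] independent, gives the other. *)
Lemma dim_orth U : (\dim U + \dim (orth U))%N = n.
Proof.
have dimV : \dim {: 'rV[R]_n} = n by rewrite dimvf /= /dim /= mul1n.
apply/eqP; rewrite eqn_leq; apply/andP; split.
  by rewrite -dimv_disjoint_sum ?capv_orth // -[leqRHS]dimV dimvS ?subvf.
rewrite -[leqLHS]dimV -(limg_ker_dim (linfun (mulmxr (\matrix_(j < n, i < \dim U)
  (vbasis U)`_i 0 j))) fullv) capfv addnC leq_add2r.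
by apply: leq_trans (dimvS (subvf _)) _; rewrite dimvf /= /dim /= mul1n.
Qed.

Lemma orthK U : orth (orth U) = U.
Proof.
apply/esym/eqP; rewrite eqEdim; apply/andP; split.
  by apply/subvP => u Uu; apply/orthP => v /orthP/(_ u Uu); rewrite dotC.
by rewrite -(leq_add2r (\dim (orth U))) dim_orth addnC dim_orth.
Qed.

Lemma addv_orth U : (U + orth U)%VS = fullv.
Proof.
apply/eqP; rewrite eqEdim subvf /= dimv_disjoint_sum ?capv_orth // dim_orth.
by rewrite dimvf /= /dim /= mul1n.
Qed.

(** This supplies all the directions and functionals chosen below: a vector
    orthogonal to some given ones that still pairs positively with another. *)
Lemma orth_separate U c : c \notin U -> exists2 v, v \in orth U & 0 < dot c v.
Proof.
rewrite -{1}(orthK U) => /orthP cU.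
have [v vU cv] : exists2 v, v \in orth U & dot c v != 0.
  apply: contrapT => noV; apply: cU => v vU; apply/eqP; rewrite dotC.
  by apply: contrapT => /negP cv; apply: noV; exists v.
have [cv_gt|cv_le] := ltP 0 (dot c v); first by exists v.
exists (- v); first by rewrite memvN.
by rewrite dotNr oppr_gt0 lt_neqAle cv.
Qed.

End dot.

(** * Faces of polyhedra given by linear inequalities *)

Section inequalities.
Variables (R : realType) (n : nat).
Implicit Types (s : seq ('rV[R]_n * R)) (p : 'rV[R]_n * R).
Implicit Types (u v w x y z c : 'rV[R]_n).

Definition feasible s x := all (fun p => dot p.1 x <= p.2) s.

Definition tight x p := dot p.1 x == p.2.

(** For feasible [x] and [y] this says that [y] lies in the smallest face of the
    polyhedron that contains [x]. Faces are handled throughout by points of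
    their relative interiors, [x] standing for the smallest face containing it;
    then [in_face s x y /\ in_face s y x] is equality of faces. *)
Definition in_face s x y := all (fun p => tight x p ==> tight y p) s.

Definition normals s x : {vspace 'rV[R]_n} :=
  <<[seq p.1 | p <- s & tight x p]>>%VS.

(** The codimension of the smallest face containing [x], which is also the
    dimension of its normal cone. *)
Definition codim s x := \dim (normals s x).

(** Triviality of the recession cone; for a nonempty polyhedron this is
    boundedness. *)
Definition bounded s := forall u, u != 0 -> exists2 p, p \in s & 0 < dot p.1 u.

Lemma in_faceP s x y :
  reflect (forall p, p \in s -> tight x p -> tight y p) (in_face s x y).
Proof.
apply: (iffP allP) => [H p /H/implyP //|H p ps]; apply/implyP; exact: H.
Qed.

Lemma in_face_refl s x : in_face s x x.
Proof. exact/in_faceP. Qed.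

Lemma in_face_trans s y x z : in_face s x y -> in_face s y z -> in_face s x z.
Proof.
by move=> /in_faceP xy /in_faceP yz; apply/in_faceP => p ps /(xy p ps)/(yz p ps).
Qed.

Lemma normals_tight s x p : p \in s -> tight x p -> p.1 \in normals s x.
Proof. by move=> ps px; apply/memv_span/map_f; rewrite mem_filter px. Qed.

Lemma orth_normalsP s x u :
  reflect (forall p, p \in s -> tight x p -> dot p.1 u = 0)
          (u \in orth (normals s x)).
Proof.
apply: (iffP idP) => [/orthP ux p ps px|ux].
  by apply: ux; apply: normals_tight.
by apply: orth_span => _ /mapP[p + ->]; rewrite mem_filter => /andP[? ?]; apply: ux.
Qed.

Lemma normalsS s x y : in_face s x y -> (normals s x <= normals s y)%VS.
Proof.
move=> /in_faceP xy; apply: sub_span => _ /mapP[p + ->].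
by rewrite !mem_filter => /andP[px ps]; apply: map_f; rewrite mem_filter xy.
Qed.

Lemma codimS s x y : in_face s x y -> (codim s x <= codim s y)%N.
Proof. by move=> xy; apply/dimvS/normalsS. Qed.

Lemma codim_le s x : (codim s x <= n)%N.
Proof. by rewrite -[leqRHS](dim_orth (normals s x)) leq_addr. Qed.

Lemma in_face_orth s x y : in_face s x y -> y - x \in orth (normals s x).
Proof.
move=> /in_faceP xy; apply/orth_normalsP => p ps px.
by rewrite dotBr (eqP px) (eqP (xy p ps px)) subrr.
Qed.

(** A face contained in another one of the same dimension is equal to it: equal
    dimension makes the two spans of normals agree, and a normal in the span of
    those tight at [x] is constant on the smallest face containing [x]. *)
Lemma in_face_sym s x y :
  in_face s x y -> (codim s y <= codim s x)%N -> in_face s y x.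
Proof.
move=> xy yx; have/eqP Nxy : normals s x == normals s y.
  by rewrite eqEdim normalsS.
apply/in_faceP => p ps py; have /orthP := in_face_orth xy.
rewrite Nxy => /(_ _ (normals_tight ps py))/eqP.
by rewrite dotBr subr_eq0 /tight => /eqP <-.
Qed.

Lemma codim_ltS s x y : in_face s x y -> ~~ in_face s y x ->
  (codim s x < codim s y)%N.
Proof.
by move=> xy; apply: contraR; rewrite -leqNgt => /(in_face_sym xy).
Qed.

Lemma vertex_eq s x y : codim s x = n -> in_face s x y -> y = x.
Proof.
move=> xn /in_face_orth; have := dim_orth (normals s x).
rewrite -[\dim (normals s x)]/(codim s x) xn -[RHS]addn0 => /eqP.
rewrite eqn_add2l dimv_eq0 => /eqP ->.
by rewrite memv0 subr_eq0 => /eqP.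
Qed.

Lemma normals_ltS s x y q : in_face s x y -> q \in s -> tight y q ->
  q.1 \notin normals s x -> (codim s x < codim s y)%N.
Proof.
move=> xy qs qy; apply: contraR; rewrite -leqNgt => yx.
have/eqP -> : normals s x == normals s y by rewrite eqEdim normalsS.
exact: normals_tight.
Qed.

Lemma step1 p x u : dot p.1 x <= p.2 -> (tight x p -> dot p.1 u <= 0) ->
  exists2 e : R, 0 < e & forall e', 0 < e' -> e' <= e ->
    dot p.1 (x + e' *: u) <= p.2 /\
    tight (x + e' *: u) p = tight x p && (dot p.1 u == 0).
Proof.
rewrite le_eqVlt /tight => /orP[/eqP xp|xp].
  rewrite xp eqxx => /(_ isT) up; exists 1 => // e e0 _.
  rewrite dotDr dotZr xp gerDl pmulr_rle0 //; split=> //.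
  by rewrite addrC -subr_eq0 addrK mulf_eq0 gt_eqF.
move=> _; have d0 : 0 < `|dot p.1 u| + 1 by rewrite ltr_wpDl.
exists ((p.2 - dot p.1 x) / (`|dot p.1 u| + 1)).
  by rewrite divr_gt0 ?subr_gt0.
move=> e e0; rewrite ler_pdivlMr // => le_e.
rewrite (lt_eqF xp) /= dotDr dotZr.
suff lt_p : dot p.1 x + e * dot p.1 u < p.2 by rewrite ltW // lt_eqF.
have : e * dot p.1 u <= e * `|dot p.1 u| by rewrite ler_pM2l // ler_norm.
by move: le_e; lra.
Qed.

(** Leaving [x] along an admissible direction, the constraints that were slack
    stay slack for a while, so the tight ones are known exactly. *)
Lemma step s x u : feasible s x ->
  (forall p, p \in s -> tight x p -> dot p.1 u <= 0) ->
  exists2 e : R, 0 < e & feasible s (x + e *: u) /\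
    forall p, p \in s -> tight (x + e *: u) p = tight x p && (dot p.1 u == 0).
Proof.
move=> xs us.
suff [e e0 He] : exists2 e : R, 0 < e & forall e', 0 < e' -> e' <= e ->
    forall p, p \in s -> dot p.1 (x + e' *: u) <= p.2 /\
    tight (x + e' *: u) p = tight x p && (dot p.1 u == 0).
  exists e => //; split; last by move=> p /(He e e0 (lexx e)) [].
  by apply/allP => p /(He e e0 (lexx e)) [].
elim: s xs us => [|q s IH] /=; first by exists 1.
case/andP => xq xs us; have [e e0 He] := step1 xq (us q (mem_head _ _)).
have [|e1 e10 He1] := IH xs; first by move=> p ps; apply: us; rewrite inE ps orbT.
exists (Num.min e e1); first by rewrite lt_min e0.
move=> e' e'0; rewrite le_min => /andP[le1 le2] p; rewrite inE.
by case/orP => [/eqP ->|]; [apply: He | apply: He1].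
Qed.

Lemma step_orth s x u : feasible s x -> u \in orth (normals s x) ->
  exists2 e : R, 0 < e & feasible s (x + e *: u).
Proof.
move=> xs /orth_normalsP ux; have [|e e0 []] := @step s x u xs; last by exists e.
by move=> p ps px; rewrite ux.
Qed.

(** Every small move in a direction orthogonal to the tight normals is possible,
    as is the opposite move; a functional maximal at [x] therefore kills all
    these directions, which puts it in the span of the tight normals. *)
Lemma max_normals s x c : feasible s x ->
  (forall y, feasible s y -> dot c y <= dot c x) -> c \in normals s x.
Proof.
move=> xs cx; rewrite -(orthK (normals s x)).
have le0 u : u \in orth (normals s x) -> dot c u <= 0.
  move=> /(step_orth xs)[e e0 /cx].
  by rewrite dotDr gerDl dotZr pmulr_rle0.
apply/orthP => u ux; apply/eqP; rewrite dotC eq_le le0 //=.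
by have := le0 (- u); rewrite memvN dotNr oppr_le0 => ->.
Qed.

Lemma max_in_face s x y c : feasible s x ->
  (forall y, feasible s y -> dot c y <= dot c x) -> in_face s x y ->
  dot c y = dot c x.
Proof.
move=> xs /(max_normals xs) cx /in_face_orth /orthP /(_ c cx) /eqP.
by rewrite dotBr subr_eq0 => /eqP.
Qed.

(** Every face is exposed: the sum of the tight normals at [x] is maximal exactly
    where all of them are tight. *)
Lemma expose s x : feasible s x -> exists2 c,
  forall y, feasible s y -> dot c y <= dot c x &
  forall y, feasible s y -> dot c x <= dot c y -> in_face s x y.
Proof.
move=> xs; exists (\sum_(p <- s | tight x p) p.1) => y /allP ys.
  rewrite !dot_suml big_seq_cond [leRHS]big_seq_cond.
  by apply: ler_sum => p /andP[/ys yp /eqP ->].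
move=> le_xy; have : \sum_(p <- s | tight x p && (p \in s)) (p.2 - dot p.1 y) = 0.
  apply/eqP; rewrite eq_le; apply/andP; split; last first.
    by apply: sumr_ge0 => p /andP[_ /ys]; rewrite subr_ge0.
  under eq_bigl do rewrite andbC.
  rewrite -big_seq_cond sumrB -dot_suml subr_le0; apply: le_trans le_xy.
  by rewrite dot_suml; apply: ler_sum => p /eqP <-.
move/eqP; rewrite psumr_eq0 => [/allP H|p /andP[_ /ys]]; last by rewrite subr_ge0.
apply/in_faceP => p ps px; have := H p ps.
by rewrite px ps /= subr_eq0 /tight eq_sym.
Qed.

(** Ray shooting: going along [u], a constraint with positive slope becomes tight
    while the point is still feasible. *)
Lemma hit s x u : feasible s x -> (exists2 p, p \in s & 0 < dot p.1 u) ->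
  exists2 t : R, 0 <= t & feasible s (x + t *: u) /\
    exists p, [/\ p \in s, 0 < dot p.1 u & tight (x + t *: u) p].
Proof.
elim: s => [|q s IH] /=; first by move=> _ [].
case/andP=> xq xs ex_p.
pose good := exists2 p, p \in s & 0 < dot p.1 u.
have t0 : 0 < dot q.1 u -> 0 <= (q.2 - dot q.1 x) / dot q.1 u.
  by move=> uq; rewrite divr_ge0 ?subr_ge0 // ltW.
have tq t : dot q.1 (x + t *: u) = dot q.1 x + t * dot q.1 u by rewrite dotDr dotZr.
have qe : 0 < dot q.1 u ->
    dot q.1 (x + ((q.2 - dot q.1 x) / dot q.1 u) *: u) = q.2.
  by move=> uq; rewrite tq divfK ?gt_eqF // addrC subrK.
have [ex_s|no_s] := pselect good.
  have [t t_ge0 [ts [p [ps pu pt]]]] := IH xs ex_s.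
  have [uq|uq] := ltP 0 (dot q.1 u); last first.
    exists t => //; rewrite ts tq andbT; split; last first.
      by exists p; rewrite inE ps orbT.
    by apply: le_trans xq; rewrite gerDl mulr_ge0_le0.
  have [le_t|lt_t] := leP t ((q.2 - dot q.1 x) / dot q.1 u).
    exists t => //; rewrite ts tq andbT; split; last first.
      by exists p; rewrite inE ps orbT.
    by move: le_t; rewrite ler_pdivlMr // lerBrDl.
  exists ((q.2 - dot q.1 x) / dot q.1 u); first exact: t0.
  rewrite /tight qe // lexx /=; split; last first.
    by exists q; rewrite mem_head qe.
  apply/allP => r rs; have /allP/(_ r rs) := xs; have /allP/(_ r rs) := ts.
  rewrite !dotDr !dotZr; set e := _ / _ in lt_t * => tr xr.
  have e0 : 0 <= e by apply: t0.
  have [dr|dr] := leP 0 (dot r.1 u).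
    by apply: le_trans tr; rewrite lerD2l ler_wpM2r // ltW.
  by apply: le_trans xr; rewrite gerDl mulr_ge0_le0 // ltW.
have uq : 0 < dot q.1 u.
  case: ex_p => p; rewrite inE => /orP[/eqP -> //|ps pu].
  by case: no_s; exists p.
exists ((q.2 - dot q.1 x) / dot q.1 u); first exact: t0.
rewrite /tight qe // lexx /=; split; last first.
  by exists q; rewrite mem_head qe.
apply/allP => r rs; have /allP/(_ r rs) := xs => xr.
rewrite dotDr dotZr; apply: le_trans xr; rewrite gerDl mulr_ge0_le0 ?t0 //.
by rewrite leNgt; apply/negP => ru; apply: no_s; exists r.
Qed.

(** Each constraint that is not tight on all of [F] can
    be made slack by passing to a midpoint, and slack constraints remain so. *)
Lemma relint s (F : 'rV[R]_n -> Prop) x :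
  F x -> (forall y, F y -> feasible s y) ->
  (forall y z, F y -> F z -> F (2^-1 *: (y + z))) ->
  exists2 x0, F x0 & forall y, F y -> in_face s x0 y.
Proof.
move=> Fx + Fmid; elim: s => [|q s IH] Fs; first by exists x.
have [|x1 Fx1 x1P] := IH; first by move=> y /Fs /= /andP[].
have [Fq|/existsNP[y /not_implyP[Fy yq]]] := pselect (forall y, F y -> tight y q).
  exists x1 => // y Fy; apply/andP.
  by split; [rewrite (Fq y Fy) implybT|apply: x1P].
exists (2^-1 *: (x1 + y)); first exact: Fmid.
move=> z Fz; apply/in_faceP => p; rewrite inE /tight dotZr dotDr => ps.
have /allP/(_ p) := Fs _ Fx1; rewrite inE => /(_ ps) x1p.
have /allP/(_ p) := Fs _ Fy; rewrite inE => /(_ ps) yp mid.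
have Ey : dot p.1 y = p.2 by move: mid => /eqP; lra.
have Ex : tight x1 p by rewrite /tight; apply/eqP; move: mid => /eqP; lra.
case/orP: ps => [/eqP pq|ps]; first by case: yq; rewrite /tight -pq Ey.
by have /in_faceP/(_ p ps Ex) := x1P z Fz.
Qed.

End inequalities.

(** * Edges and vertices *)

Section edges.
Variables (R : realType) (n : nat).
Implicit Types (s : seq ('rV[R]_n * R)) (p : 'rV[R]_n * R).
Implicit Types (u v w x y z c g : 'rV[R]_n).

(** The simplex step, in the form needed here: if [g] increases from [v] to [z],
    it increases along a face of dimension one more than that of [v], taken
    inside the smallest face containing [z]. As long as the dimension is too
    large, there is a direction orthogonal to [g] and to the tight normals at
    [z] that reaches another facet of the cone of [v]; contracting towards [v]
    brings the point reached back into the polyhedron. The assumption on [g]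
    says that it is constant on the face of [v]. *)
Lemma improve s v z g : feasible s v -> feasible s z -> in_face s z v ->
  g \in normals s v -> dot g v < dot g z -> exists z',
  [/\ feasible s z', (codim s z').+1 = codim s v, in_face s z z',
      in_face s z' v & dot g v < dot g z'].
Proof.
move=> vs zs zv gv.
have [m] := ubnP (codim s v - codim s z); elim: m z zs zv => // m IH z zs zv.
rewrite ltnS => le_m lt_g.
have notvx x : dot g v < dot g x -> ~~ in_face s v x.
  move=> lt_gx; apply/negP => /in_face_orth /orthP /(_ g gv) /eqP.
  by rewrite dotBr subr_eq0 gt_eqF.
have := codim_ltS zv (notvx z lt_g).
rewrite leq_eqVlt => /orP[/eqP ?|lt_zv].
  by exists z; split=> //; apply: in_face_refl.
have [p [ps pv pU]] : exists p,
    [/\ p \in s, tight v p & p.1 \notin (normals s z + <[g]>)%VS].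
  apply: contrapT => noP; move: lt_zv; apply/negP; rewrite -leqNgt.
  have : (normals s v <= normals s z + <[g]>)%VS.
    apply/span_subvP => _ /mapP[p + ->]; rewrite mem_filter => /andP[pv ps].
    by apply: contrapT => /negP pU; apply: noP; exists p.
  move/dimvS/leq_trans; apply; apply: leq_trans (dimv_add_leqif _ _) _.
  by rewrite -[leqRHS]addn1 leq_add2l dim_vline leq_b1.
have [u /orthP uU pu] := orth_separate pU.
have uz q : q \in s -> tight z q -> dot q.1 u = 0.
  by move=> qs qz; apply/uU/(subvP (addvSl _ _))/normals_tight.
have ug : dot g u = 0 by apply/uU/(subvP (addvSr _ _))/memv_line.
pose sv := [seq q <- s | tight v q].
(* Only the constraints tight at [v] matter: near [v] the polyhedron is the
   cone that they cut out. *)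
have [||t t0 [zts [q [+ qu qt]]]] := @hit _ _ sv z u.
- by apply/allP => q; rewrite mem_filter => /andP[_]; apply: (allP zs).
- by exists p; rewrite ?mem_filter ?pv.
rewrite mem_filter => /andP[qv qs]; set z1 := z + _ in zts qt.
have z1g : dot g z1 = dot g z by rewrite dotDr dotZr ug mulr0 addr0.
have [|e e0 [z2s z2t]] := @step _ _ s v (z1 - v) vs.
  move=> r rs rv; rewrite dotBr (eqP rv) subr_le0.
  by apply: (allP zts); rewrite mem_filter rv.
have tz2 r : r \in s -> tight (v + e *: (z1 - v)) r = tight v r && tight z1 r.
  move=> rs; rewrite z2t //; case rv: (tight v r) => //=.
  by rewrite dotBr subr_eq0 (eqP rv).
have g2 : dot g v < dot g (v + e *: (z1 - v)).
  by rewrite dotDr dotZr ltrDl pmulr_rgt0 // dotBr subr_gt0 z1g.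
have zz2 : in_face s z (v + e *: (z1 - v)).
  apply/in_faceP => r rs rz; rewrite tz2 // (in_faceP _ _ _ zv) //=.
  by rewrite /tight dotDr dotZr uz // mulr0 addr0.
have z2v : in_face s (v + e *: (z1 - v)) v.
  by apply/in_faceP => r rs; rewrite tz2 // => /andP[].
have lt_z2 : (codim s z < codim s (v + e *: (z1 - v)))%N.
  apply: (normals_ltS zz2 qs); first by rewrite tz2 // qv.
  apply/negP => /(subvP (addvSl _ <[g]>)) /uU /eqP.
  by rewrite gt_eqF.
have [|//|z' [? ? z2z' ? ?]] := IH _ z2s z2v.
  by apply: leq_trans le_m; rewrite ltn_sub2l // (leq_ltn_trans _ lt_zv).
by exists z'; split=> //; apply: in_face_trans z2z'.
Qed.

(** The face lattice is graded. Applying [improve] with the negative of a normal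
    tight at [v] but not at [x] lowers the codimension of [v] one unit at a
    time, until it is one more than that of [x]. *)
Lemma in_face_graded s x v : feasible s x -> feasible s v -> in_face s x v ->
  (codim s x < codim s v)%N -> exists u,
  [/\ feasible s u, codim s u = (codim s x).+1, in_face s x u & in_face s u v].
Proof.
move=> xs; have [m] := ubnP (codim s v); elim: m v => // m IH v.
rewrite ltnS => le_m vs xv lt_xv.
have : ~~ in_face s v x by apply: contraL lt_xv => /codimS; rewrite -leqNgt.
case/allPn => p ps; rewrite negb_imply => /andP[pv px].
have lt_p : dot (- p.1) v < dot (- p.1) x.
  rewrite !dotNl ltrN2 (eqP pv) lt_neqAle px.
  exact: (allP xs).
have [|z' [z's z'v xz' zv _]] := improve vs xs xv _ lt_p.
  by rewrite memvN normals_tight.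
move: lt_xv; rewrite -z'v ltnS leq_eqVlt => /orP[/eqP eq_x|lt_x].
  by exists v; split; rewrite ?eq_x //; apply: in_face_refl.
have [|u [us uc xu uz']] := IH z' _ z's xz' lt_x; first by rewrite z'v.
by exists u; split=> //; apply: in_face_trans zv.
Qed.

(** Shooting rays along which [g] does not decrease makes the tight normals span
    more and more, and ends at a vertex. *)
Lemma vertex_above s x g : bounded s -> feasible s x -> exists v,
  [/\ feasible s v, codim s v = n, in_face s x v & dot g x <= dot g v].
Proof.
move=> bs; have [m] := ubnP (n - codim s x); elim: m x => // m IH x.
rewrite ltnS => le_m xs; have := codim_le s x.
rewrite leq_eqVlt => /orP[/eqP xn|lt_n].
  by exists x; split=> //; apply: in_face_refl.
have [u [u0 ux gu]] : exists u,
    [/\ u != 0, u \in orth (normals s x) & 0 <= dot g u].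
  pose u := vpick (orth (normals s x)).
  have u0 : u != 0.
    rewrite vpick0 -dimv_eq0 -lt0n -(ltn_add2l (\dim (normals s x))).
    by rewrite addn0 dim_orth.
  have [gu|/ltW gu] := leP 0 (dot g u); first by exists u; rewrite memv_pick.
  by exists (- u); rewrite oppr_eq0 memvN memv_pick dotNr oppr_ge0.
have [t t0 [xts [p [ps pu pt]]]] := hit xs (bs u u0).
have/orth_normalsP ux0 := ux.
have xxt : in_face s x (x + t *: u).
  apply/in_faceP => q qs qx.
  by rewrite /tight dotDr dotZr ux0 // mulr0 addr0.
have [|v [vs vn xv gv]] := IH (x + t *: u) _ xts.
  suff lt_xt : (codim s x < codim s (x + t *: u))%N.
    by apply: leq_trans le_m; rewrite ltn_sub2l.
  apply: (normals_ltS xxt ps pt); apply/negP => px.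
  by move/orthP: ux => /(_ _ px) /eqP; rewrite gt_eqF.
exists v; split=> //; first exact: in_face_trans xv.
by apply: le_trans gv; rewrite dotDr dotZr lerDl mulr_ge0.
Qed.

Lemma feasible_mid s x y : feasible s x -> feasible s y ->
  feasible s (2^-1 *: (x + y)).
Proof.
move=> /allP xs /allP ys; apply/allP => p ps; rewrite dotZr dotDr.
by have := xs p ps; have := ys p ps; lra.
Qed.

Lemma tight_mid s x y p : feasible s x -> feasible s y -> p \in s ->
  tight (2^-1 *: (x + y)) p = tight x p && tight y p.
Proof.
move=> /allP xs /allP ys ps; rewrite /tight dotZr dotDr.
have := xs p ps; have := ys p ps => yp xp.
by apply/eqP/andP => [eq_p|[/eqP -> /eqP ->]]; [split; apply/eqP|]; lra.
Qed.

(** From a vertex [v] at which [g] is not maximal one can go up along an edge to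
    another vertex. The edge, given by its interior point [z], can be chosen in
    any face containing both [v] and a better point [q]; this serves to stay
    inside the face where another functional is maximal. *)
Lemma step_up s v q g : bounded s -> feasible s v -> codim s v = n ->
  feasible s q -> dot g v < dot g q -> exists z v',
  [/\ [/\ feasible s z, (codim s z).+1 = n, in_face s z v, dot g v < dot g z &
          in_face s (2^-1 *: (v + q)) z],
      feasible s v', codim s v' = n, in_face s z v' & dot g v < dot g v'].
Proof.
move=> bs vs vn qs lt_g; have ms := feasible_mid vs qs.
have mv : in_face s (2^-1 *: (v + q)) v.
  by apply/in_faceP => p ps; rewrite (tight_mid vs qs ps) => /andP[].
have gm : dot g v < dot g (2^-1 *: (v + q)) by rewrite dotZr dotDr; lra.
have gN : g \in normals s v.
  suff -> : normals s v = fullv by rewrite memvf.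
  by apply/eqP; rewrite eqEdim subvf dimvf /= /dim /= mul1n -/(codim s v) vn /=.
have [z [zs zn mz zv gz]] := improve vs ms mv gN gm.
have [v' [v's v'n zv' gv']] := vertex_above g bs zs.
exists z, v'; split=> //; last exact: lt_le_trans gv'.
by split=> //; rewrite zn.
Qed.

(** A vertex is determined by the set of constraints that are tight at it. *)
Lemma vertices_finite s : exists vs : seq 'rV[R]_n,
  forall v, feasible s v -> codim s v = n -> v \in vs.
Proof.
pose Q (m : seq bool) v := [/\ feasible s v, codim s v = n & map (tight v) s = m].
exists [seq xget 0 (Q (val m)) | m : (size s).-tuple bool] => v vs vn.
apply/mapP; exists (map_tuple (tight v) (in_tuple s)); first by rewrite mem_enum.
rewrite /=.
case: xgetP => [w -> [ws wn /eq_in_map wv]|/(_ v)]; last by case.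
by apply: esym; apply: vertex_eq vn _; apply/in_faceP => p ps; rewrite wv.
Qed.

(** Induction along a functional, well founded as there are finitely many
    vertices; it stands for walking up until no step is possible. *)
Lemma vertex_ind s g (Q : 'rV[R]_n -> Prop) :
  (forall v, feasible s v -> codim s v = n ->
     (forall w, feasible s w -> codim s w = n -> dot g v < dot g w -> Q w) ->
     Q v) ->
  forall v, feasible s v -> codim s v = n -> Q v.
Proof.
move=> IHQ; have [vs vsP] := vertices_finite s => v.
have [m] := ubnP (count (fun w => dot g v < dot g w) vs).
elim: m v => // m IH v; rewrite ltnS => le_m vf vn.
apply: IHQ => // w wf wn lt_vw; apply: IH => //; apply: leq_trans le_m.
have /vsP/(_ wn) wvs := wf; elim: vs wvs {vsP} => //= a vs IHvs.
have le_vs : (count (fun x => (dot g w < dot g x)%R) vs <=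
    count (fun x => (dot g v < dot g x)%R) vs)%N.
  by apply: sub_count => x; apply: lt_trans.
rewrite inE => /orP[/eqP <-|/IHvs]; first by rewrite ltxx lt_vw add0n add1n ltnS.
move=> lt_vs; rewrite -addnS; apply: leq_add lt_vs.
by case: (ltP (dot g w) (dot g a)) => // /(lt_trans lt_vw) ->.
Qed.

End edges.

(** * Connectivity of the graph of a polytope *)

Section connectivity.
Variables (R : realType) (n : nat).
Implicit Types (s : seq ('rV[R]_n * R)) (p : 'rV[R]_n * R) (k : nat).
Implicit Types (u v w x y z c g r : 'rV[R]_n) (Rm : seq 'rV[R]_n).

(** Points of [Rm] stand for deleted faces: the smallest face containing [x]
    contains a relative interior point of a face [F] exactly when it contains
    [F]. *)
Definition avoids s Rm x := all (fun r => ~~ in_face s x r) Rm.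

Definition node s k x := feasible s x && (codim s x == k).

(** The first alternative identifies relative interior points of the same face,
    the second one links two faces of codimension [k] through a face of
    codimension [k - 1] that contains both and avoids [Rm]. *)
Definition adjacent s k Rm x y := [/\ node s k x, node s k y &
  in_face s x y /\ in_face s y x \/
  exists z, [/\ feasible s z, (codim s z).+1 = k, avoids s Rm z,
                in_face s z x & in_face s z y]].

Definition conn s k Rm := clos_refl_trans _ (adjacent s k Rm).

Lemma avoidsP s Rm x :
  reflect (forall r, r \in Rm -> ~~ in_face s x r) (avoids s Rm x).
Proof. exact: allP. Qed.

Lemma avoidsW s Rm x y : in_face s x y -> avoids s Rm x -> avoids s Rm y.
Proof.
move=> xy /avoidsP xR; apply/avoidsP => r /xR; apply: contra.
exact: in_face_trans.
Qed.

Lemma adjacent_sym s k Rm x y : adjacent s k Rm x y -> adjacent s k Rm y x.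
Proof.
case=> xs ys [[xy yx]|[z [zs zk zR zx zy]]]; split=> //; first by left.
by right; exists z.
Qed.

Lemma conn_sym s k Rm x y : conn s k Rm x y -> conn s k Rm y x.
Proof.
elim=> [a b /adjacent_sym|a|a b c _ ba _ cb]; first exact: rt_step.
  exact: rt_refl.
exact: rt_trans cb ba.
Qed.

(** If [l] does not exceed [lam] on the deleted points, then a walk that increases
    [l] from a surviving vertex of level at least [lam] never meets them. Indeed
    an edge leaving [v] upwards lies above [v], so a deleted point on it could
    only be [v] itself. *)
Lemma climb s Rm l (lam : R) v : bounded s ->
  (forall r, r \in Rm -> dot l r <= lam) -> avoids s Rm v ->
  feasible s v -> codim s v = n -> (forall r, r \in Rm -> feasible s r) ->
  lam <= dot l v ->
  exists b, [/\ feasible s b, codim s b = n,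
    forall y, feasible s y -> dot l y <= dot l b & conn s n Rm v b].
Proof.
move=> bs lR + vs vn Rs; move: v vs vn.
apply: (@vertex_ind _ _ s l) => v vs vn IH vR lv.
have [vmax|/existsNP[q /not_implyP[qs /negP]]] :=
  pselect (forall y, feasible s y -> dot l y <= dot l v).
  by exists v; split=> //; apply: rt_refl.
rewrite -ltNge => lt_q.
have [z [w [[zs zn zv lz _] ws wn zw lw]]] := step_up bs vs vn qs lt_q.
(* A deleted [r] on the edge would be [z + t (v - z)] with [t >= 1], beyond [v]
   as seen from [z]; the constraints tight at [v] exclude this unless they are
   all tight at [r]. *)
have zR : avoids s Rm z.
  apply/avoidsP => r rR; apply: contra (avoidsP _ _ _ vR r rR) => zr.
  have zv0 : v - z != 0.
    by rewrite subr_eq0; apply: contraTneq lz => ->; rewrite ltxx.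
  have dim1 : \dim (orth (normals s z)) = 1%N.
    apply/eqP; rewrite -(eqn_add2l (\dim (normals s z))) dim_orth addn1.
    by rewrite -/(codim s z) zn.
  have /eqP line : (<[v - z]> == orth (normals s z))%VS.
    by rewrite eqEdim dim1 dim_vline zv0 -memvE in_face_orth.
  have : r - z \in <[v - z]>%VS by rewrite line in_face_orth.
  case/vlineP => t rz.
  have t1 : 0 <= t - 1.
    have : dot l (r - z) = t * dot l (v - z) by rewrite rz dotZr.
    rewrite !dotBr; have := lR r rR; nra.
  apply/in_faceP => p ps pv; rewrite /tight eq_le (allP (Rs r rR)) //=.
  have : dot p.1 (r - z) = t * dot p.1 (v - z) by rewrite rz dotZr.
  rewrite !dotBr (eqP pv); have := allP zs p ps; nra.
have [||b [bs' bn bmax wb]] := IH w ws wn lw.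
- exact: avoidsW zR.
- exact: le_trans (ltW lw).
exists b; split=> //; apply: rt_trans wb; apply: rt_step; split.
- by rewrite /node vs vn eqxx.
- by rewrite /node ws wn eqxx.
- by right; exists z.
Qed.

(** The face where [l] is maximal contains no deleted point, so inside it one may
    walk towards any chosen vertex [b], increasing a functional that exposes
    [b]. *)
Lemma top_face_conn s Rm l v b : bounded s ->
  (forall r, r \in Rm -> dot l r < dot l b) ->
  feasible s b -> codim s b = n -> (forall y, feasible s y -> dot l y <= dot l b) ->
  feasible s v -> codim s v = n -> dot l v = dot l b -> conn s n Rm v b.
Proof.
move=> bds lR bs bn bmax vs vn; have [g gmax gface] := expose bs.
move: v vs vn; apply: (@vertex_ind _ _ s g) => v vs vn IH lv.
have [/(gface v vs)/(vertex_eq bn)->|gv] := leP (dot g b) (dot g v).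
  exact: rt_refl.
have [z [w [[zs zn zv gz mz] ws wn zw gw]]] := step_up bds vs vn bs gv.
have lm : dot l (2^-1 *: (v + b)) = dot l b by rewrite dotZr dotDr lv; lra.
have lface x : in_face s (2^-1 *: (v + b)) x -> dot l x = dot l b.
  move=> mx; rewrite -lm; apply: max_in_face mx; first exact: feasible_mid.
  by move=> y; rewrite lm; apply: bmax.
apply: rt_trans (IH w ws wn gw (lface _ (in_face_trans mz zw))); apply: rt_step.
split; rewrite /node ?vs ?vn ?ws ?wn ?eqxx //; right; exists z; split=> //.
apply/avoidsP => r rR; apply/negP => /(in_face_trans mz)/lface rb.
by have := lR r rR; rewrite rb ltxx.
Qed.

(** Balinski's theorem, for deleted points instead of deleted vertices. There is a
    functional [l] that is constant on the deleted points together with [x], but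
    not on the polytope: the differences to [x] span at most [size Rm]
    dimensions, fewer than the dimension [n - codim s x0] of the polytope. Up to
    replacing [l] by its opposite, [y] is not below the level of [x] and this
    level is not the highest one; then [x] and [y] both climb to the top face,
    which lies strictly above all deleted points. *)
Lemma balinski s x0 Rm x y : bounded s -> feasible s x0 ->
  (size Rm + codim s x0 < n)%N -> (forall r, r \in Rm -> feasible s r) ->
  node s n x -> node s n y -> avoids s Rm x -> avoids s Rm y ->
  conn s n Rm x y.
Proof.
move=> bs x0s sz Rs /andP[xs /eqP xn] /andP[ys /eqP yn] xR yR.
suff two_sided l q : (forall r, r \in Rm -> dot l r = dot l x) ->
    feasible s q -> dot l x < dot l q -> dot l x <= dot l y -> conn s n Rm x y.
  pose U := <<[seq r - x | r <- Rm]>>%VS.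
  have : ~~ (orth U <= normals s x0)%VS.
    have dimU : (\dim U <= size Rm)%N.
      by rewrite -(size_map (fun r => r - x)) dim_span.
    apply/negP => /dimvS; apply/negP; rewrite -ltnNge -(ltn_add2l (\dim U)).
    by rewrite dim_orth; apply: leq_ltn_trans sz; rewrite leq_add2r.
  case/subvPn => l /orthP lU /orth_separate[u ux0 lu].
  have lR r : r \in Rm -> dot l r = dot l x.
    move=> rR; apply/eqP; rewrite -subr_eq0 -dotBr dotC; apply/eqP/lU.
    by apply/memv_span/map_f.
  have lRN r : r \in Rm -> dot (- l) r = dot (- l) x.
    by move=> /lR; rewrite !dotNl => ->.
  have [lxy|lyx|exy] := ltgtP (dot l x) (dot l y).
  - by apply: (two_sided l y) => //; apply: ltW.
  - by apply: (two_sided (- l) y) => //; rewrite !dotNl ?ltW ?ltrN2.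
  have [e1 e10 q1s] := step_orth x0s ux0.
  have [|e2 e20 q2s] := @step_orth _ _ s x0 (- u) x0s; first by rewrite memvN.
  have [lt_1|le_1] := ltP (dot l x) (dot l (x0 + e1 *: u)).
    by apply: (two_sided l _ lR q1s) => //; rewrite exy.
  apply: (two_sided (- l) _ lRN q2s); rewrite !dotNl ?exy //.
  move: le_1; rewrite ltrN2 !dotDr !dotZr dotNr; nra.
move=> lR qs lt_q le_y.
have lRx r : r \in Rm -> dot l r <= dot l x by move/lR ->.
have [b [bbs bn bmax xb]] := climb bs lRx xR xs xn Rs (lexx _).
have [d [ds dn dmax yd]] := climb bs lRx yR ys yn Rs le_y.
apply: rt_trans xb _; apply: rt_trans (conn_sym yd).
apply: (top_face_conn (l := l)) => //; last first.
  by apply/eqP; rewrite eq_le dmax // bmax.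
by move=> r /lR ->; apply: lt_le_trans lt_q _; apply: dmax.
Qed.

End connectivity.

(** * Links and faces of higher dimension *)

Section links.
Variables (R : realType) (n : nat).
Implicit Types (s : seq ('rV[R]_n * R)) (p : 'rV[R]_n * R) (k : nat).
Implicit Types (u v w x y z a b c r : 'rV[R]_n) (Rm : seq 'rV[R]_n).

Definition eqn c (b : R) : seq ('rV[R]_n * R) := [:: (c, b); (- c, - b)].

(** A functional that is maximal exactly on the smallest face containing [u]. *)
Definition apex_normal s u := \sum_(p <- s | tight u p) p.1.

(** The link of the smallest face containing [u], a generalized vertex figure:
    the cone of the polyhedron at [u] is cut by a hyperplane just below the
    apex and by the space through [u] orthogonal to the face. Its faces
    correspond to the faces that properly contain [u]. Writing the link in the
    same ambient space makes the results on bounded systems apply to it. *)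
Definition link s u : seq ('rV[R]_n * R) :=
  [seq p <- s | tight u p] ++
  (eqn (apex_normal s u) (dot (apex_normal s u) u - 1) ++
   flatten [seq eqn c (dot c u) | c <- vbasis (orth (normals s u))]).

Lemma feasible_eqn c (b : R) y : feasible (eqn c b) y = (dot c y == b).
Proof. by rewrite /feasible /= andbT dotNl lerN2 eq_le. Qed.

Lemma feasible_cat s1 s2 y :
  feasible (s1 ++ s2) y = feasible s1 y && feasible s2 y.
Proof. exact: all_cat. Qed.

Lemma link_feasibleP s u y :
  reflect [/\ forall p, p \in s -> tight u p -> dot p.1 y <= p.2,
              dot (apex_normal s u) y = dot (apex_normal s u) u - 1
            & y - u \in normals s u]
          (feasible (link s u) y).
Proof.
rewrite !feasible_cat feasible_eqn.
have -> : feasible (flatten [seq eqn c (dot c u) |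
    c <- vbasis (orth (normals s u))]) y = (y - u \in normals s u).
  have feasible_eqns l : feasible (flatten [seq eqn c (dot c u) | c <- l]) y =
      all (fun c => dot c (y - u) == 0) l.
    elim: l => // c l IH; rewrite map_cons -[flatten _]/(_ ++ flatten _).
    by rewrite feasible_cat feasible_eqn IH /= dotBr subr_eq0.
  have -> : (y - u \in normals s u) =
      (y - u \in orth <<vbasis (orth (normals s u))>>%VS).
    by rewrite (span_basis (vbasisP _)) orthK.
  rewrite feasible_eqns.
  apply/allP/idP => [H|/orthP H c cT]; last by rewrite H ?memv_span.
  by apply: orth_span => c /H /eqP.
apply: (iffP and3P) => [[/allP ys /eqP -> ->]|[ys -> ->]]; split=> //.
  by move=> p ps pu; apply: ys; rewrite mem_filter pu.
by apply/allP => p; rewrite mem_filter => /andP[? ?]; apply: ys.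
Qed.

(** The equations are tight at all points of the link, so only the constraints
    inherited from [s] tell its faces apart. *)
Lemma mem_link s u y p : feasible (link s u) y -> p \in link s u ->
  (p \in s /\ tight u p) \/ tight y p /\
  p.1 \in (<[apex_normal s u]> + orth (normals s u))%VS.
Proof.
move=> /link_feasibleP[_ hy yu]; rewrite !mem_cat => /or3P[].
- by rewrite mem_filter => /andP[]; left.
- have hV := subvP (addvSl _ _) _ (memv_line (apex_normal s u)).
  rewrite !inE => /orP[]/eqP ->; right; rewrite /tight /= ?memvN ?hV ?dotNl hy //.
- case/flattenP => l /mapP[c cT ->] pe; right.
  have cO : c \in orth (normals s u) by apply: vbasis_mem cT.
  have cy : dot c y = dot c u.
    by apply/eqP; rewrite -subr_eq0 -dotBr dotC (orthP _ _ cO _ yu).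
  have cV := subvP (addvSr <[apex_normal s u]> _) _ cO.
  move: pe; rewrite !inE => /orP[]/eqP ->;
    by rewrite /tight /= ?memvN ?cV ?dotNl cy.
Qed.

Lemma in_face_link s u y z : feasible (link s u) y -> feasible (link s u) z ->
  in_face (link s u) y z <->
  (forall p, p \in s -> tight u p -> tight y p -> tight z p).
Proof.
move=> ys zs; split=> [/in_faceP yz p ps pu|yz].
  by apply: yz; rewrite mem_cat mem_filter pu ps.
apply/in_faceP => p pl py; case: (mem_link zs pl) => [[ps pu]|[]] //.
exact: yz.
Qed.

(** A recession direction of the link lies in the cone of the polyhedron at [u],
    is killed by the sum of the tight normals and hence by each of them, so it
    is parallel to the face of [u]; it is also orthogonal to this face. *)
Lemma link_bounded s u : bounded (link s u).
Proof.
move=> w w0; apply: contrapT => noP.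
have le0 p : p \in link s u -> dot p.1 w <= 0.
  by move=> pl; rewrite leNgt; apply/negP => pw; apply: noP; exists p.
have eq0 c (b : R) : {subset eqn c b <= link s u} -> dot c w = 0.
  move=> cl; apply/eqP; rewrite eq_le (le0 (c, b)) ?cl ?inE ?eqxx //=.
  have := le0 (- c, - b); rewrite dotNl oppr_le0; apply.
  by rewrite cl ?inE ?eqxx ?orbT.
have hw : dot (apex_normal s u) w = 0.
  by apply: (eq0 _ (dot (apex_normal s u) u - 1)) => p pe; rewrite !mem_cat pe orbT.
have wN : w \in normals s u.
  rewrite -(orthK (normals s u)) -[X in orth X](span_basis (vbasisP _)).
  apply: orth_span => c cT; apply: (eq0 _ (dot c u)) => p pe.
  rewrite !mem_cat; apply/or3P/Or33/flattenP; exists (eqn c (dot c u)) => //.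
  by apply/mapP; exists c.
suff /orthP/(_ w wN)/eqP : w \in orth (normals s u) by rewrite dot_eq0 (negPf w0).
apply/orth_normalsP => p ps pu; apply/eqP; rewrite -oppr_eq0.
move/eqP: hw; rewrite dot_suml -oppr_eq0 -sumrN big_seq_cond.
rewrite psumr_eq0 => [/allP/(_ p ps)|q /andP[qs qu]]; first by rewrite ps pu.
by rewrite oppr_ge0 le0 // mem_cat mem_filter qu qs.
Qed.

(** The equations of the link contribute independently: the orthogonal complement
    of [normals s u] has dimension [n - codim s u], and the cutting hyperplane
    adds 1, since [apex_normal s u] is not constant along the segment from [u]
    to [y] while the inherited normals that are tight at [y] are. *)
Lemma codim_link s u y : feasible (link s u) y ->
  (codim (link s u) y + codim s u)%N =
  (\dim <<[seq p.1 | p <- s & tight u p && tight y p]>> + n.+1)%N.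
Proof.
move=> yl; have /link_feasibleP[_ hy yu] := yl.
set A := <<_>>%VS; set h := apex_normal s u in hy *.
set T := orth (normals s u).
have -> : codim (link s u) y = \dim (A + <[h]> + T).
  rewrite /codim -addvA; congr (\dim _); apply/eqP; rewrite eqEsubv.
  apply/andP; split.
    apply/span_subvP => _ /mapP[p + ->]; rewrite mem_filter => /andP[py].
    case/(mem_link yl) => [[ps pu]|[_]]; last exact/subvP/addvSr.
    apply/(subvP (addvSl _ _))/memv_span/mapP; exists p => //.
    by rewrite mem_filter pu py.
  have eqP' c (b : R) : dot c y = b -> {subset eqn c b <= link s u} ->
      c \in normals (link s u) y.
    move=> cy cl; rewrite -[c]/((c, b).1); apply: normals_tight.
      by rewrite cl ?inE ?eqxx.
    by rewrite /tight /= cy.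
  rewrite !subv_add; apply/and3P; split.
  - apply/span_subvP => _ /mapP[p + ->].
    rewrite mem_filter => /andP[/andP[pu py] ps]; apply: normals_tight py.
    by rewrite mem_cat mem_filter pu ps.
  - rewrite -memvE; apply: eqP' hy _ => p pe.
    by rewrite !mem_cat pe orbT.
  - rewrite -[X in (X <= _)%VS](span_basis (vbasisP T)); apply/span_subvP => c cT.
    apply: (eqP' _ (dot c u)).
      apply/eqP; rewrite -subr_eq0 -dotBr dotC.
      by have /orthP -> := vbasis_mem cT.
    move=> p pe; rewrite !mem_cat; apply/or3P/Or33/flattenP.
    by exists (eqn c (dot c u)) => //; apply/mapP; exists c.
have AN : (A <= normals s u)%VS.
  apply: sub_span => _ /mapP[p + ->]; rewrite mem_filter => /andP[/andP[pu _] ps].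
  by apply/map_f; rewrite mem_filter pu.
have hN : h \in normals s u.
  rewrite /h /apex_normal big_seq_cond; apply: memv_suml => p /andP[ps pu].
  exact: normals_tight.
have hA : h \notin A.
  have Ay : y - u \in orth A.
    apply: orth_span => _ /mapP[p + ->]; rewrite mem_filter.
    by move=> /andP[/andP[/eqP pu /eqP py] ps]; rewrite dotBr pu py subrr.
  apply/negP => hA; move/orthP: Ay => /(_ h hA)/eqP.
  by rewrite dotBr hy addrC addKr oppr_eq0 oner_eq0.
rewrite dimv_disjoint_sum; last first.
  apply/eqP; rewrite -subv0 -(capv_orth (normals s u)) capvS //.
  by rewrite subv_add AN -memvE.
rewrite dimv_disjoint_sum; last first.
  apply/eqP; rewrite -subv0; apply/subvP => w; rewrite memv_cap => /andP[wA].
  case/vlineP => t wt; have [t0|t0] := eqVneq t 0.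
    by rewrite wt t0 scale0r mem0v.
  by case/negP: hA; rewrite -[h](scalerK t0) -wt memvZ.
have h0 : h != 0 by apply: contraNneq hA => ->; apply: mem0v.
rewrite dim_vline h0 -!addnA; congr (_ + _)%N.
by rewrite [(\dim T + _)%N]addnC dim_orth.
Qed.

(** The central projection from [u] onto the link. *)
Lemma to_link s u x : feasible s u -> feasible s x -> ~~ in_face s u x ->
  exists2 y, feasible (link s u) y &
    forall p, p \in s -> tight u p -> tight y p = tight x p.
Proof.
move=> us xs ux; set h := apex_normal s u.
have hx : dot h (x - u) < 0.
  rewrite lt_neqAle; apply/andP; split; last first.
    rewrite /h dot_suml big_seq_cond sumr_le0 // => p /andP[ps /eqP pu].
    by rewrite dotBr pu subr_le0 (allP xs).
  apply: contra ux; rewrite -oppr_eq0 /h dot_suml -sumrN big_seq_cond.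
  rewrite psumr_eq0 => [/allP H|p /andP[ps /eqP pu]]; last first.
    by rewrite oppr_ge0 dotBr pu subr_le0 (allP xs).
  apply/in_faceP => p ps pu; have := H p ps; rewrite ps pu /= oppr_eq0 dotBr.
  by rewrite subr_eq0 (eqP pu).
have : x - u \in (normals s u + orth (normals s u))%VS by rewrite addv_orth memvf.
case/memv_addP => w wN [v vT xuE].
have pw p : p \in s -> tight u p -> dot p.1 w = dot p.1 (x - u).
  move=> ps pu; rewrite xuE dotDr.
  by rewrite [dot _ v](orthP _ _ vT) ?addr0 // normals_tight.
have hw : dot h w = dot h (x - u).
  rewrite /h !dot_suml big_seq_cond [RHS]big_seq_cond.
  by apply: eq_bigr => p /andP[]; apply: pw.
pose t := - (dot h w)^-1; have t0 : 0 < t by rewrite oppr_gt0 invr_lt0 hw.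
exists (u + t *: w); last first.
  move=> p ps pu; rewrite /tight dotDr dotZr (eqP pu) pw // dotBr (eqP pu).
  rewrite -subr_eq0 addrC addKr mulf_eq0 gt_eqF //=.
  by rewrite subr_eq0.
apply/link_feasibleP; split.
- move=> p ps pu; rewrite dotDr dotZr (eqP pu) pw // gerDl pmulr_rle0 //.
  by rewrite dotBr (eqP pu) subr_le0 (allP xs).
- by rewrite dotDr dotZr /t mulNr mulVf // hw lt_eqF.
- by rewrite addrC addKr memvZ.
Qed.

(** A point of the link, moved close to [u], satisfies all constraints. *)
Lemma from_link s u y : feasible s u -> feasible (link s u) y ->
  exists2 x, feasible s x &
    forall p, p \in s -> tight x p = tight u p && tight y p.
Proof.
move=> us /link_feasibleP[ys _ _].
have [|e e0 [xs xt]] := @step _ _ s u (y - u) us.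
  by move=> p ps pu; rewrite dotBr (eqP pu) subr_le0 ys.
exists (u + e *: (y - u)) => // p ps; rewrite xt //.
by case pu: (tight u p) => //=; rewrite dotBr subr_eq0 (eqP pu).
Qed.

(** The faces of codimension [k] around a face [u] of codimension [k + 1] are the
    vertices of the link of [u], and those of codimension [k - 1] are its edges.
    The link has dimension [k - codim s x0], so that its connectivity is again
    Balinski's theorem. The deleted points, being outside [u] once some
    surviving face contains [u], are projected to the link: this is where
    deleting arbitrary points, and not only vertices, is essential. *)
Lemma star_conn s x0 u k Rm x y :
  feasible s x0 -> in_face s x0 u -> (size Rm + codim s x0 < k)%N ->
  feasible s u -> codim s u = k.+1 ->
  (forall r, r \in Rm -> feasible s r) ->
  node s k x -> node s k y -> avoids s Rm x -> avoids s Rm y ->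
  in_face s x u -> in_face s y u -> conn s k Rm x y.
Proof.
move=> x0s x0u sz us uk Rs xk yk xR yR xu yu.
have below w : (codim s w <= k)%N -> ~~ in_face s u w.
  by move=> wk; apply/negP => /codimS; rewrite uk leqNgt ltnS wk.
have Ru r : r \in Rm -> ~~ in_face s u r.
  by move=> rR; apply: contra (avoidsP _ _ _ xR r rR); apply: in_face_trans.
(* [a] is a point of the link that the constraints tight at [u] do not
   distinguish from [w], such as the projection of [w]. *)
pose img w a := feasible (link s u) a /\
  forall p, p \in s -> tight u p -> tight a p = tight w p.
pose f r := xget 0 (img r).
have fP r : r \in Rm -> img r (f r).
  move=> rR; have [a aL ra] := to_link us (Rs r rR) (Ru r rR).
  by apply: xgetPex; exists a.
have img_face w w' a a' : img w a -> img w' a' -> in_face s w u ->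
    in_face s w w' <-> in_face (link s u) a a'.
  move=> [al wa] [al' wa'] wu.
  split=> [/in_faceP ww'|aa'].
    by apply/(in_face_link al al') => p ps pu; rewrite wa // wa' //; apply: ww'.
  apply/in_faceP => p ps pw; have pu := in_faceP _ _ _ wu p ps pw.
  have /(_ p ps pu) := (in_face_link al al').1 aa'.
  by rewrite wa // wa' //; apply.
have img_codim w a : img w a -> in_face s w u ->
    (codim (link s u) a + k = codim s w + n)%N.
  move=> [al wa] /in_faceP wu; have := codim_link al.
  rewrite uk !addnS => -[->]; congr (\dim <<map _ _>> + _)%N.
  apply: eq_in_filter => p ps.
  by case pu: (tight u p); [rewrite wa | apply/esym/negP => /(wu p ps); rewrite pu].
have img_avoids w a : img w a -> in_face s w u ->
    avoids s Rm w <-> avoids (link s u) (map f Rm) a.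
  move=> wa wu; split=> /avoidsP H; apply/avoidsP.
    move=> _ /mapP[r rR ->]; apply: contra (H r rR).
    by move=> /(img_face _ _ _ _ wa (fP r rR) wu).2.
  move=> r rR; apply: contra (H (f r) (map_f f rR)).
  by move=> /(img_face _ _ _ _ wa (fP r rR) wu).1.
have pull a : feasible (link s u) a -> exists w,
    [/\ feasible s w, in_face s w u & img w a].
  move=> al; have [w ws wt] := from_link us al; exists w; split=> //.
    by apply/in_faceP => p ps; rewrite wt // => /andP[].
  by split=> // p ps pu; rewrite wt // pu.
have img_node w a : img w a -> in_face s w u -> feasible s w ->
    node (link s u) n a -> node s k w.
  move=> wa wu ws /andP[_ /eqP an]; rewrite /node ws /=.
  by have := img_codim _ _ wa wu; rewrite an addnC => /addIn ->; rewrite eqxx.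
have transfer a b : conn (link s u) n (map f Rm) a b -> forall w w',
    img w a -> img w' b -> node s k w -> node s k w' ->
    in_face s w u -> in_face s w' u -> conn s k Rm w w'.
  move=> ab0; have {ab0} ab := clos_rt_rt1n _ _ _ _ ab0.
  elim: ab => {a b} [a|a c b [an cn ac] _ IH] w w' wa wb wn wn' wu wu'.
    apply: rt_step; split=> //; left.
    split; [apply/(img_face _ _ _ _ wa wb wu)|apply/(img_face _ _ _ _ wb wa wu')];
      exact: in_face_refl.
  have /andP[cl _] := cn; have [v [vs vu vc]] := pull c cl.
  have vn : node s k v by apply: (img_node v c).
  apply: rt_trans (IH v w' vc wb vn wn' vu wu'); apply: rt_step; split=> //.
  case: ac => [[ac ca]|[z [zl zn zR za zc]]].
    left; split; first exact/(img_face _ _ _ _ wa vc wu).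
    exact/(img_face _ _ _ _ vc wa vu).
  have [v' [v's v'u v'z]] := pull z zl.
  right; exists v'; split=> //.
  - apply/eqP; rewrite -(eqn_add2l (codim (link s u) z)) (img_codim _ _ v'z v'u).
    by rewrite -addSnnS zn addnC.
  - exact/(img_avoids _ _ v'z v'u).
  - exact/(img_face _ _ _ _ v'z wa v'u).
  - exact/(img_face _ _ _ _ v'z vc v'u).
have /andP[xs /eqP xc] := xk; have /andP[ys /eqP yc] := yk.
have lift w : feasible s w -> (codim s w <= k)%N -> exists a, img w a.
  by move=> ws wk; have [a al wa] := to_link us ws (below w wk); exists a.
have [a0 x0a] : exists a, img x0 a.
  by apply: lift => //; apply: leq_trans (ltnW sz); rewrite leq_addl.
have [a xa] : exists a, img x a by apply: lift; rewrite ?xc.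
have [b yb] : exists b, img y b by apply: lift; rewrite ?yc.
apply: (transfer a b) => //; apply: (@balinski _ _ (link s u) a0).
- exact: link_bounded.
- by case: x0a.
- rewrite size_map -(ltn_add2r k) -addnA (img_codim _ _ x0a x0u) addnA.
  by rewrite (addnC n) ltn_add2r.
- by move=> _ /mapP[r rR ->]; case: (fP r rR).
- rewrite /node (proj1 xa) -(eqn_add2r k) (img_codim _ _ xa xu) xc.
  by rewrite addnC eqxx.
- rewrite /node (proj1 yb) -(eqn_add2r k) (img_codim _ _ yb yu) yc.
  by rewrite addnC eqxx.
- exact/(img_avoids _ _ xa xu).
- exact/(img_avoids _ _ yb yu).
Qed.

(** Downward induction on [k], from Balinski's theorem at [k = n]. Faces of
    codimension [k] containing no deleted point have subfaces of codimension
    [k + 1], which a fortiori contain none. By induction these are joined by a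
    chain in which neighbours lie in a common surviving face of codimension
    [k]. Around each member of the chain, [star_conn] joins the incoming face
    of codimension [k] to the outgoing one. *)
Theorem faces_conn s x0 k Rm x y : bounded s -> feasible s x0 ->
  (forall w, feasible s w -> in_face s x0 w) -> (k <= n)%N ->
  (size Rm + codim s x0 < k)%N -> (forall r, r \in Rm -> feasible s r) ->
  node s k x -> node s k y -> avoids s Rm x -> avoids s Rm y ->
  conn s k Rm x y.
Proof.
move=> bs x0s x0P kn + Rs.
have [m] := ubnP (n - k); elim: m k kn x y => // m IH k kn x y; rewrite ltnS.
move=> le_m sz xk yk xR yR; move: (kn); rewrite leq_eqVlt => /orP[/eqP kE|lt_k].
  by rewrite kE in sz xk yk *; apply: (balinski bs x0s).
have up w : node s k w -> exists2 v, node s k.+1 v & in_face s w v.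
  move=> /andP[ws /eqP wk]; have [v [vs vn wv _]] := vertex_above 0 bs ws.
  have [|v' [v's v'k wv' _]] := in_face_graded ws vs wv; first by rewrite wk vn.
  by exists v'; rewrite // /node v's v'k wk /=.
have [u uk xu] := up x xk; have [v vk yv] := up y yk.
have : conn s k.+1 Rm u v.
  apply: IH => //; last exact: avoidsW yR; last exact: avoidsW xR.
    by apply: leq_trans le_m; rewrite ltn_sub2l.
  exact: leq_trans sz _.
move=> uv0; have {uv0} uv := clos_rt_rt1n _ _ _ _ uv0.
have star w a b : node s k.+1 w -> node s k a -> node s k b -> avoids s Rm a ->
    avoids s Rm b -> in_face s a w -> in_face s b w -> conn s k Rm a b.
  by move=> /andP[ws /eqP wk]; apply: (star_conn x0s _ sz) => //; apply: x0P.
elim: uv x xk xR xu uk vk yv {up} => {u v} [u|u w v [_ wk uw] _ IHuv];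
  move=> x xk xR xu uk vk yv.
  exact: (star u).
case: uw => [[uw _]|[z [zs zk zR zu zw]]].
  by apply: IHuv => //; apply: in_face_trans uw.
have zn : node s k z by move: zk => [zk]; rewrite /node zs zk /=.
by apply: rt_trans (star u x z _ _ _ _ _ _ _) (IHuv z _ _ _ _ _ _).
Qed.

End links.

(** * Linear inequalities for a convex hull *)

Section hull.
Variables (R : realType) (n : nat).
Implicit Types (s : seq ('rV[R]_n * R)) (p : 'rV[R]_n * R).
Implicit Types (u v w x y z c : 'rV[R]_n).

Lemma convex_setP (A : set 'rV[R]_n) : @convex_set R 'rV[R]_n A <->
  forall x y (t : R), A x -> A y -> 0 <= t -> t <= 1 ->
    A (t *: x + (1 - t) *: y).
Proof.
split=> [cA x y t Ax Ay t0 t1|cA x y l /set_mem Ax /set_mem Ay]; apply/set_mem.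
  have := cA x y (Itv01 t0 t1); rewrite !inE => /(_ Ax Ay); exact.
by apply/mem_set/mem_set/cA.
Qed.

Lemma exists_between (L U : seq R) :
  (forall l u : R, l \in L -> u \in U -> l <= u) ->
  exists t : R, (forall l, l \in L -> l <= t) /\ (forall h : R, h \in U -> t <= h).
Proof.
elim: L => [_|a L IH LU].
  elim: U => [|b U [t [_ tU]]]; first by exists 0.
  exists (Num.min t b); split=> // u; rewrite inE ge_min.
  by case/orP=> [/eqP ->|/tU ->]; rewrite ?lexx ?orbT.
have [|t [Lt tU]] := IH; first by move=> l u lL; apply: LU; rewrite inE lL orbT.
exists (Num.max t a); split=> [l|u uU]; last by rewrite ge_max tU ?LU ?mem_head.
by rewrite inE le_max => /orP[/eqP ->|/Lt ->]; rewrite ?lexx ?orbT.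
Qed.

(** Fourier-Motzkin elimination of a single scalar [t] from inequalities
    [t * a <= beta - dot c x], encoded as [(a, (c, beta))]. *)
Definition eliminate (L : seq (R * ('rV[R]_n * R))) : seq ('rV[R]_n * R) :=
  [seq q.2 | q <- L & q.1 == 0] ++
  [seq (a.1 *: b.2.1 - b.1 *: a.2.1, a.1 * b.2.2 - b.1 * a.2.2) |
     a <- [seq a <- L | 0 < a.1], b <- [seq b <- L | b.1 < 0]].

Lemma eliminateP (L : seq (R * ('rV[R]_n * R))) x :
  feasible (eliminate L) x <->
  exists t, forall q, q \in L -> t * q.1 <= q.2.2 - dot q.2.1 x.
Proof.
pose f (q : R * ('rV[R]_n * R)) := q.2.2 - dot q.2.1 x.
split=> [/allP xE|[t tL]].
  have [l u|t [lo hi]] := @exists_between [seq f q / q.1 | q <- L & q.1 < 0]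
      [seq f q / q.1 | q <- L & 0 < q.1].
    case/mapP=> b + -> /mapP[a + ->]; rewrite !mem_filter.
    move=> /andP[b0 bL] /andP[a0 aL].
    rewrite ler_pdivlMr // mulrAC ler_ndivrMr // /f.
    have : (a.1 *: b.2.1 - b.1 *: a.2.1, a.1 * b.2.2 - b.1 * a.2.2)
        \in eliminate L.
      rewrite mem_cat; apply/orP; right; apply/allpairsP; exists (a, b).
      by rewrite !mem_filter a0 b0.
    by move/xE; rewrite /= dotBl !dotZl ; lra.
  exists t => q qL; have [q0|q0|q0] := ltgtP q.1 0.
  - by rewrite -ler_ndivrMr //; apply/lo/mapP; exists q; rewrite ?mem_filter ?q0.
  - by rewrite -ler_pdivlMr //; apply/hi/mapP; exists q; rewrite ?mem_filter ?q0.
  - rewrite q0 mulr0 subr_ge0; apply: xE; rewrite mem_cat; apply/orP; left.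
    by apply/mapP; exists q; rewrite ?mem_filter ?q0 ?eqxx.
apply/allP => p; rewrite mem_cat => /orP[/mapP[q + ->]|].
  by rewrite mem_filter => /andP[/eqP q0 /tL]; rewrite q0 mulr0 subr_ge0.
case/allpairsP=> -[a b] [/= + + ->]; rewrite !mem_filter.
move=> /andP[a0 /tL ta] /andP[b0 /tL tb] /=.
rewrite dotBl !dotZl.
have := ler_wpM2l (ltW a0) tb; have := ler_wnM2l (ltW b0) ta; lra.
Qed.

(** On a set contained in every convex set around [vs], the functional [dot u] is
    bounded by its maximum on [vs], which leaves no ray in direction [u]. *)
Lemma hull_bounded s (vs : seq 'rV[R]_n) :
  (exists x, feasible s x) ->
  (forall C : set 'rV[R]_n, @convex_set R 'rV[R]_n C ->
     (forall v, v \in vs -> C v) ->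
     forall x, feasible s x -> C x) ->
  bounded s.
Proof.
move=> [x xs] sC u u0; apply: contrapT => noP.
have le0 p : p \in s -> dot p.1 u <= 0.
  by move=> ps; rewrite leNgt; apply/negP => pu; apply: noP; exists p.
have [M MP] : exists M, forall v, v \in vs -> dot u v <= M.
  have [|M [MP _]] := @exists_between [seq dot u v | v <- vs] [::]; first by [].
  by exists M => v vv; apply/MP/map_f.
have uu : 0 < dot u u by rewrite dot_gt0.
have ray t : 0 <= t -> dot u x + t * dot u u <= M.
  move=> t0; rewrite -dotZr -dotDr.
  suff : [set y | dot u y <= M]%classic (x + t *: u) by [].
  apply: sC => //; last first.
    apply/allP => p ps; rewrite dotDr dotZr.
    by apply: le_trans (allP xs p ps); rewrite gerDl mulr_ge0_le0 ?le0.
  apply/convex_setP => y z t' /= yM zM t'0 t'1.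
  by rewrite dotDr !dotZr; nra.
have t0 : 0 <= (`|M - dot u x| + 1) / dot u u.
  by rewrite divr_ge0 ?addr_ge0 // ltW.
have := ray _ t0; rewrite divfK ?gt_eqF //.
have := ler_norm (M - dot u x); lra.
Qed.

Lemma feasible_convex s : @convex_set R 'rV[R]_n [set x | feasible s x]%classic.
Proof.
apply/convex_setP => x y t /= /allP xs /allP ys t0 t1; apply/allP => p ps.
by rewrite dotDr !dotZr; have := xs p ps; have := ys p ps; nra.
Qed.

(** The inequalities [0 <= t <= 1] and [dot p.1 (x - (1 - t) v) <= t p.2]: they
    say that [x] is [(1 - t) v + t y] with [y] feasible for [s], the case [t = 0]
    being understood by homogenization. *)
Definition join_system s v : seq (R * ('rV[R]_n * R)) :=
  [:: (-1, (0, 0)); (1, (0, 1))] ++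
  [seq (dot p.1 v - p.2, (p.1, dot p.1 v)) | p <- s].

Lemma join_systemP s v x :
  feasible (eliminate (join_system s v)) x <->
  exists t, [/\ 0 <= t, t <= 1 & forall p, p \in s ->
    dot p.1 (x - (1 - t) *: v) <= t * p.2].
Proof.
split=> [/eliminateP[t tL]|[t [t0 t1 tL]]].
  exists t; split.
  - by have := tL (-1, (0, 0)); rewrite inE eqxx /= dot0l => /(_ isT); lra.
  - by have := tL (1, (0, 1)); rewrite !inE eqxx orbT /= dot0l => /(_ isT); lra.
  - move=> p ps; have := tL (dot p.1 v - p.2, (p.1, dot p.1 v)).
    rewrite mem_cat (map_f (fun p => (dot p.1 v - p.2, (p.1, dot p.1 v)))) ?orbT //.
    by move=> /(_ isT) /=; rewrite dotBr dotZr; lra.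
apply/eliminateP; exists t => q; rewrite mem_cat !inE.
case/orP=> [/orP[]/eqP -> /=|/mapP[p ps -> /=]]; rewrite ?dot0l; try lra.
by have := tL p ps; rewrite dotBr dotZr; lra.
Qed.

(** Half of the Minkowski-Weyl theorem, by adding one point at a time. For [t = 0]
    the join system yields a recession direction [x - v], so boundedness of the
    smaller hull forces [x = v]. *)
Lemma hull_system v (vs : seq 'rV[R]_n) : exists s,
  (forall w, w \in v :: vs -> feasible s w) /\
  (forall C : set 'rV[R]_n, @convex_set R 'rV[R]_n C ->
     (forall w, w \in v :: vs -> C w) ->
     forall x, feasible s x -> C x).
Proof.
elim: vs v => [|w vs IH] v.
  pose s := flatten [seq eqn c (dot c v) | c <- vbasis (fullv : {vspace 'rV[R]_n})].
  have sP x : feasible s x <-> x = v.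
    split=> [xs|->].
      apply/eqP; rewrite -subr_eq0 -memv0 -(capv_orth fullv) memv_cap memvf /=.
      rewrite -[X in orth X](span_basis (vbasisP _)); apply: orth_span => c cV.
      apply/eqP; rewrite dotBr subr_eq0 -feasible_eqn; apply/allP => p pe.
      apply: (allP xs); apply/flattenP; exists (eqn c (dot c v)) => //.
      by apply/mapP; exists c.
    apply/allP => p /flattenP[l /mapP[c _ ->] pc].
    suff /allP : feasible (eqn c (dot c v)) v by apply.
    by rewrite feasible_eqn.
  exists s; split=> [w|C _ vC x /sP ->]; last by apply: vC; rewrite mem_head.
  by rewrite inE => /eqP ->; apply/sP.
have [s [ws sC]] := IH w.
have bs : bounded s.
  by apply: hull_bounded sC; exists w; apply: ws; rewrite mem_head.
exists (eliminate (join_system s v)); split=> [x|C cC vC x].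
  rewrite inE => /orP[/eqP ->|/ws /allP xs]; apply/join_systemP.
    by exists 0; split=> // p _; rewrite subr0 scale1r subrr dotC dot0l mul0r.
  by exists 1; split=> // p ps; rewrite subrr scale0r subr0 mul1r xs.
case/join_systemP=> t [t0 t1 tP].
have [t_eq0|t_neq0] := eqVneq t 0.
  suff -> : x = v by apply: vC; rewrite mem_head.
  apply/eqP; rewrite -subr_eq0; apply: contraT => /bs[p ps pv].
  by have := tP p ps; rewrite t_eq0 subr0 scale1r mul0r leNgt pv.
have tgt : 0 < t by rewrite lt_neqAle eq_sym t_neq0.
have -> : x = t *: (t^-1 *: (x - (1 - t) *: v)) + (1 - t) *: v.
  by rewrite scalerA divff // scale1r subrK.
apply: (convex_setP C).1 => //; last by apply: vC; rewrite mem_head.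
apply: sC => //; first by move=> y yv; apply: vC; rewrite inE yv orbT.
by apply/allP => p ps; rewrite dotZr mulrC ler_pdivrMr // mulrC tP.
Qed.

Lemma polytope_system (P : set 'rV[R]_n) : polytope P -> (exists x, P x) ->
  exists2 s, bounded s & forall x, P x <-> feasible s x.
Proof.
case=> S /finite_seqP[[|v vs] ->] -> [x0 x0P].
  by have := x0P set0%classic; case; split=> // x y t; rewrite inE.
have [s [vss sC]] := hull_system v vs; exists s.
  by apply: hull_bounded sC; exists v; apply: vss; rewrite mem_head.
move=> x; split=> [xP|xs C [cC vC]].
  by apply: (xP [set x | feasible s x]%classic); split=> //; apply: feasible_convex.
exact: sC xs.
Qed.

End hull.

(** * The normal fan *)

Section normal_fan.
Variables (R : realType) (n : nat) (s : seq ('rV[R]_n * R)).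
Implicit Types (P F : set 'rV[R]_n) (x y c : 'rV[R]_n).

Definition cone_at x : set 'rV[R]_n :=
  [set c | forall y, feasible s y -> dot c y <= dot c x]%classic.

(** A normal tight at [x] is itself a functional that is maximal at [x]. *)
Lemma cone_at_sub x y : feasible s x -> feasible s y ->
  (cone_at x `<=` cone_at y)%classic <-> in_face s x y.
Proof.
move=> xs ys; split=> [xy|xy c cx z zs]; last first.
  by rewrite (max_in_face xs cx xy) cx.
apply/in_faceP => p ps /eqP px.
have /xy/(_ x xs) : cone_at x p.1 by move=> z zs; rewrite px (allP zs).
by rewrite px => py; rewrite /tight eq_le py (allP ys).
Qed.

Lemma cone_at_eq x y : feasible s x -> feasible s y -> in_face s x y ->
  in_face s y x -> cone_at x = cone_at y.
Proof. by move=> xs ys xy yx; apply/seteqP; split; apply/cone_at_sub. Qed.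

Lemma dim_cone_at x : feasible s x -> Defs.dim (cone_at x) = codim s x.
Proof.
move=> xs; have [dirN dir_min] := directionP (cone_at x).
suff : (direction (cone_at x) == normals s x)%VS.
  by move=> /eqP dE; rewrite /Defs.dim dE.
rewrite eqEsubv; apply/andP; split.
  apply: dir_min => c d cx dx; apply: memvB; exact: max_normals.
apply/span_subvP => _ /mapP[p + ->]; rewrite mem_filter => /andP[/eqP px ps].
rewrite -[p.1]subr0; apply: dirN => y ys; last by rewrite !dot0l.
by rewrite px (allP ys).
Qed.

Lemma normal_cone_relint P F c x : (forall y, P y <-> feasible s y) ->
  F = max_face P c -> F x -> (forall y, F y -> in_face s x y) ->
  normal_cone P F = cone_at x.
Proof.
move=> Ps FE Fx xF; have xP : P x by move: Fx; rewrite FE => -[].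
apply/seteqP; split=> d.
  by move=> /(_ x Fx) [_ dx] y /Ps /dx.
move=> dx y Fy; have yP : P y by move: Fy; rewrite FE => -[].
split=> // z /Ps zs; rewrite (max_in_face _ dx (xF y Fy)) ?dx //.
exact/Ps.
Qed.

(** Each face has a relative interior point, and its normal cone consists of the
    functionals that are maximal at this point. *)
Lemma normal_fanP P C : (forall y, P y <-> feasible s y) ->
  normal_fan P C <-> exists2 x, feasible s x & C = cone_at x.
Proof.
move=> Ps; split=> [[F [[x Fx] [c FE]] <-]|[x xs ->]].
  have [||x0 Fx0 x0F] := @relint _ _ s F x Fx.
  - by move=> y; rewrite FE => -[/Ps].
  - rewrite FE => y z [yP ymax] [zP zmax]; split.
      by apply/Ps/feasible_mid; apply/Ps.
    move=> w wP; rewrite dotZr dotDr; have := ymax w wP; have := zmax w wP; lra.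
  exists x0; last exact: normal_cone_relint FE Fx0 x0F.
  by apply/Ps; move: Fx0; rewrite FE => -[].
have [c cmax cface] := expose xs.
have Fx : max_face P c x by split=> [|y /Ps]; [apply/Ps | apply: cmax].
exists (max_face P c); first by split; [exists x | exists c].
apply: normal_cone_relint Fx _ => // y [/Ps ys yx]; apply: cface => //.
by apply: yx; apply/Ps.
Qed.

(** Differences of points of the polytope are orthogonal to the normals tight at
    a relative interior point, so full dimension leaves no room for normals. *)
Lemma full_dimensional_relint P : (forall y, P y <-> feasible s y) ->
  full_dimensional P -> (exists x, P x) -> exists x0,
  [/\ feasible s x0, forall y, feasible s y -> in_face s x0 y & codim s x0 = 0%N].
Proof.
move=> Ps fullP [x /Ps xs].
have [||x0 x0s x0P] := @relint _ _ s (feasible s) x xs => //.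
  by move=> y z; apply: feasible_mid.
exists x0; split=> //; have [_ dir_min] := directionP P.
have /dimvS : (direction P <= orth (normals s x0))%VS.
  apply: dir_min => y z /Ps ys /Ps zs; apply/orth_normalsP => p ps px.
  by rewrite dotBr !(eqP (in_faceP _ _ _ (x0P _ _) p ps px)) ?subrr.
rewrite -[\dim (direction P)]/(Defs.dim P) fullP => le_n.
apply/eqP; rewrite -leqn0 -(leq_add2r (\dim (orth (normals s x0)))) add0n.
by rewrite [leqLHS]dim_orth.
Qed.

End normal_fan.

Theorem corollary2 (R : realType) (n k : nat) (P : set 'rV[R]_n)
    (polyP : polytope P) (ratP : rational_polytope P)
    (fullP : full_dimensional P) (hk : (1 <= k <= n)%N) :
  m_connected_codim1 k (skeleton (normal_fan P) k) k.
Proof.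
move=> S Sfacets cardS; have /andP[k0 kn] := hk.
have [x1 x1P] : exists x, P x.
  apply: contrapT => noP; have [_ dir_min] := directionP P.
  have : (direction P <= 0)%VS.
    by apply: dir_min => x y Px; case: noP; exists x.
  move/dimvS; rewrite dimv0 -[\dim _]/(Defs.dim P) fullP leqn0 => /eqP n0.
  by move: kn; rewrite n0 leqNgt k0.
have [s bs Ps] := polytope_system polyP (ex_intro _ x1 x1P).
have [x0 [x0s x0P x00]] := full_dimensional_relint Ps fullP (ex_intro _ x1 x1P).
have facetP C : facets (skeleton (normal_fan P) k) k C <->
    exists2 x, node s k x & C = cone_at s x.
  split=> [[[/(normal_fanP _ Ps)[x xs ->] _] dimC]|[x /andP[xs /eqP xk] ->]].
    by exists x; rewrite // /node xs -dim_cone_at // dimC eqxx.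
  have dk : Defs.dim (cone_at s x) = k by rewrite dim_cone_at.
  by split=> //; split; [apply/(normal_fanP _ Ps); exists x | rewrite dk].
(* Each deleted cone is represented by a relative interior point of its face. *)
have [Rm [Rm_size RmS SRm]] : exists Rm, [/\ size Rm = k.-1,
    forall r, r \in Rm -> node s k r /\ S (cone_at s r) &
    forall C, S C -> exists2 r, r \in Rm & C = cone_at s r].
  have [f [fS _ fsurj]] : exists f, set_bij `I_(k.-1) S f.
    by apply/card_set_bijP; rewrite card_eq_sym.
  pose rep C := xget 0 [set x | node s k x /\ C = cone_at s x]%classic.
  have repP C : S C -> node s k (rep C) /\ C = cone_at s (rep C).
    move=> /Sfacets/facetP[x xk CE]; rewrite /rep.
    apply: (@xgetPex _ 0 [set x | node s k x /\ C = cone_at s x]%classic).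
    by exists x.
  exists [seq rep (f i) | i <- iota 0 k.-1]; split.
  - by rewrite size_map size_iota.
  - move=> _ /mapP[i + ->]; rewrite mem_iota => /fS Sfi.
    by have [? <-] := repP _ Sfi.
  - move=> C SC; have [i ik <-] := fsurj C SC; exists (rep (f i)).
      by apply: map_f; rewrite mem_iota.
    by have [] := repP (f i) (fS i ik).
have Rs r : r \in Rm -> feasible s r by move=> /RmS[/andP[]].
have conn_path x y : conn s k Rm x y -> exists2 p : seq (set 'rV[R]_n),
    path (fun a b => `[< in_same_hyperedge
      (delete (facet_ridge_hypergraph (skeleton (normal_fan P) k) k) S) a b >])
      (cone_at s x) p & last (cone_at s x) p = cone_at s y.
  move=> xy0; have {xy0} xy := clos_rt_rt1n _ _ _ _ xy0.
  elim: xy => {x y} [x|x y z [xk yk xy] _ [p pP pz]]; first by exists [::].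
  have /andP[xs _] := xk; have /andP[ys _] := yk.
  case: xy => [[xy yx]|[w [ws wk wR wx wy]]].
    by exists p; rewrite (cone_at_eq xs ys xy yx).
  exists (cone_at s y :: p) => //=; rewrite pP andbT; apply/asboolP.
  exists (ridge_hyperedge (skeleton (normal_fan P) k) k (cone_at s w)).
  have wC : (Defs.dim (cone_at s w)).+1 = k by rewrite dim_cone_at.
  split; last 2 first.
  - by split; [apply/facetP; exists x | apply/cone_at_sub].
  - by split; [apply/facetP; exists y | apply/cone_at_sub].
  split.
    exists (cone_at s w) => //; split=> //; split; last by rewrite -wC.
    by apply/(normal_fanP _ Ps); exists w.
  apply/seteqP; split=> // C [[_ wsub] /SRm[r rR CE]].
  move: wsub; rewrite CE => /(cone_at_sub ws (Rs r rR)).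
  by apply/negP/(avoidsP _ _ _ wR).
have avoidP x : node s k x -> ~ S (cone_at s x) -> avoids s Rm x.
  move=> /andP[xs /eqP xk] xS; apply/avoidsP => r rR; apply/negP => xr.
  have [/andP[rs /eqP rk] Sr] := RmS r rR.
  case: xS; rewrite (cone_at_eq xs rs xr) //.
  by apply: in_face_sym xr _; rewrite xk rk.
move=> C D [/facetP[x xk ->] xS] [/facetP[y yk ->] yS].
apply: conn_path; apply: (faces_conn bs x0s) => //.
- by rewrite Rm_size x00 addn0 prednK.
- exact: avoidP.
- exact: avoidP.
Qed.
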